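(* Let $d\ge3$, let $\mathcal{G}$ be either $\mathbb{Z}^d$ or $\mathbb{T}_L=(\mathbb{Z}/2L\mathbb{Z})^d$ for some integer $L\ge1$, and let $\theta\in[0,1]$, with $\theta\neq 0$ if $\mathcal{G}=\mathbb{T}_L$. Let $K\subset\mathcal{G}$ be finite, $A\subset\{0,1\}^K$ and $h\in\mathbb{R}$. Then $$-\frac{d\,\mathbb{P}_\theta^{\mathcal{G}}[A^h]}{dh}=\mathbb{E}_\theta^{\mathcal{G}}\Big[1_{A^h}(\varphi)\cdot\Big(\sum_{x\in K}\kappa_x^{\mathrm{tr}}\varphi_x\Big)\Big].$$
   Context: $\mathcal{G}$ carries the nearest-neighbor graph structure. For $\theta\in[0,1]$, $P_\theta^x$ is the law of the Markov chain $(X_n)_{n\ge0}$ on $\mathcal{G}\cup\{\Delta\}$ started at $x\in\mathcal{G}$, where $\Delta$ is an absorbing cemetery state: from $y\in\mathcal{G}$ the chain jumps to $\Delta$ with probability $\theta$, and with probability $1-\theta$ it makes a simple random walk step on $\mathcal{G}$, i.e. moves to $y\pm e_i$, each of these $2d$ choices ($1\le i\le d$, sign $\pm$) having probability $\frac{1-\theta}{2d}$. The Green function is $g_\theta(x,y)=\sum_{n\ge0}P_\theta^x[X_n=y]$, $x,y\in\mathcal{G}$. $\mathbb{P}_\theta^{\mathcal{G}}$ (expectation $\mathbb{E}_\theta^{\mathcal{G}}$) is the law on $\mathbb{R}^{\mathcal{G}}$ under which the canonical coordinates $\varphi=(\varphi_x)_{x\in\mathcal{G}}$ form a centered Gaussian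 field with covariance $g_\theta(\cdot,\cdot)$. For finite $K\subset\mathcal{G}$, $A\subset\{0,1\}^K$ and $h\in\mathbb{R}$, let $A^h=\{(1\{\varphi_x\ge h\})_{x\in K}\in A\}\subset\mathbb{R}^{\mathcal{G}}$. With $\widetilde H_K=\inf\{n\ge1:X_n\in K\}$, let $\kappa_x^{\mathrm{tr}}=P_\theta^x[\widetilde H_K=\infty]$ for $x\in K$. *)

(* Defs.v *)
From HB Require Import structures.
From mathcomp Require Import all_boot all_order all_algebra finmap.
From mathcomp Require Import all_classical all_reals all_analysis.

Set Implicit Arguments.
Unset Strict Implicit.
Unset Printing Implicit Defensive.

Import Order.TTheory GRing.Theory Num.Theory.
Import numFieldNormedType.Exports.

Local Open Scope classical_set_scope.
Local Open Scope ring_scope.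

(* [Torus L] is (Z/2LZ)^d; it is meant for 1 <= L only, because 'Z_0 is
   isomorphic to Z/2Z. *)
Inductive ambient := Zlattice | Torus of nat.

Definition coordinate (G : ambient) : countNzRingType :=
  match G with
  | Zlattice => int
  | Torus L => 'Z_(2 * L)
  end.

(* The unit vector e_i is [delta_mx 0 i]. *)
Notation vertex d G := 'rV[coordinate G]_d.

(* Transition probabilities on G + {Delta}, with [None] as the cemetery Delta.
   The 2d choices (i, sign) are counted with multiplicity: on the torus with
   L = 1, y + e_i and y - e_i coincide. *)
Definition step_prob (R : realType) (d : nat) (G : ambient) (theta : R)
    (u v : option (vertex d G)) : R :=
  match u, v with
  | None, None => 1
  | None, Some _ => 0
  | Some _, None => theta
  | Some y, Some z =>
      \sum_(i < d) ((1 - theta) / (2 * d)%:R * (z == y + delta_mx 0 i)%:R +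
                    (1 - theta) / (2 * d)%:R * (z == y - delta_mx 0 i)%:R)
  end.

Definition trajectory (d : nat) (G : ambient) := nat -> option (vertex d G).

(* G being countable, the events {X_n = u} generate the product of the
   discrete sigma-algebras. *)
Definition path_cylinders (d : nat) (G : ambient) : set (set (trajectory d G)) :=
  [set B | exists n u, B = [set w | w n = u]].

Notation path_space d G :=
  (g_sigma_algebraType (@path_cylinders d G)).

Definition is_killed_walk_law (R : realType) (d : nat) (G : ambient) (theta : R)
    (x : vertex d G) (P : probability (path_space d G) R) : Prop :=
  P [set w | w 0%N = Some x] = 1%E /\
  forall (n : nat) (s : trajectory d G),
    P [set w | forall k, (k <= n.+1)%N -> w k = s k] =
    (P [set w | forall k, (k <= n)%N -> w k = s k] *
     (step_prob theta (s n) (s n.+1))%:E)%E.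

Definition green (R : realType) (d : nat) (G : ambient)
    (P : vertex d G -> probability (path_space d G) R) (x y : vertex d G) : \bar R :=
  (\sum_(0 <= n <oo) P x [set w | w n = Some y])%E.

(* The infimum of the empty set is +oo. *)
Definition return_time (R : realType) (d : nat) (G : ambient)
    (K : {fset vertex d G}) (w : trajectory d G) : \bar R :=
  ereal_inf [set n%:R%:E | n in
    [set n : nat | (1 <= n)%N /\ exists2 y, y \in K & w n = Some y]].

Definition kappa_tr (R : realType) (d : nat) (G : ambient)
    (P : vertex d G -> probability (path_space d G) R)
    (K : {fset vertex d G}) (x : vertex d G) : R :=
  fine (P x [set w | return_time R K w = +oo%E]).

(* The product Borel sigma-algebra of R^G. *)
Definition field_cylinders (R : realType) (d : nat) (G : ambient) :
    set (set (vertex d G -> R)) :=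
  [set B | exists x (V : set R), measurable V /\ B = [set phi | V (phi x)]].

Notation field_space R d G :=
  (g_sigma_algebraType (@field_cylinders R d G)).

(* The case s = 0 is separate because the library's [normal_prob m 0] is the
   uniform law on [0, 1], not the point mass at m. *)
Definition is_gaussian (R : realType) (mu : set R -> \bar R) : Prop :=
  exists m s : R, forall V : set R, measurable V ->
    mu V = if s == 0 then \d_m V else normal_prob m s V.

(* Since C takes values in the extended reals and the variances of Gaussian
   laws are finite, the covariance clause forces C to be finite. *)
Definition is_centered_gaussian_field (R : realType) (d : nat) (G : ambient)
    (C : vertex d G -> vertex d G -> \bar R)
    (P : probability (field_space R d G) R) : Prop :=
  [/\ forall (S : {fset vertex d G}) (a : vertex d G -> R),
        is_gaussian (pushforward P
          (fun phi : field_space R d G => \sum_(x <- S) a x * phi x)),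
      forall x : vertex d G,
        'E_P[fun phi : field_space R d G => phi x]%E = 0%E
    & forall x y : vertex d G,
        covariance P (fun phi : field_space R d G => phi x)
                     (fun phi : field_space R d G => phi y) = C x y].

Definition level_event (R : realType) (d : nat) (G : ambient)
    (K : {fset vertex d G}) (A : {set {ffun K -> bool}}) (h : R) :
    set (field_space R d G) :=
  [set phi | [ffun x : K => h <= phi (val x)] \in A].

(* Main.v *)
Require Import Defs.
From HB Require Import structures.
From mathcomp Require Import all_boot all_order all_algebra finmap.
From mathcomp Require Import all_classical all_reals all_analysis measurable_realfun.
From mathcomp Require Import ring lra.

Import Order.TTheory GRing.Theory Num.Theory.
Import numFieldNormedType.Exports.

Set Implicit Arguments.
Unset Strict Implicit.
Unset Printing Implicit Defensive.

Local Open Scope classical_set_scope.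
Local Open Scope ring_scope.

(** Put M = sum_K kappa_x phi_x.  Decomposing the walk from x in K at its last visit
    to K gives sum_(y in K) g(x, y) kappa_y = 1, that is Cov(phi_x, M) = 1 on K.  So
    shifting the field by the constant t on K amounts to the Cameron-Martin weight
    exp(t M - t^2 Var(M) / 2): P(A^(h - t)) = exp(- t^2 Var(M) / 2) E[1_(A^h) exp(t M)],
    and the derivative at t = 0 is E[1_(A^h) M].  The shifted and the weighted law
    have the same Laplace transform; differentiating it gives equal moments against
    exponentials, hence equal integrals of trigonometric functions, and the indicators
    of half-spaces are bounded pointwise limits of these. *)

(** Comparing Laplace transforms rather than densities means that the covariance matrix on K is
    never inverted; degeneracy shows up only as the point mass among one-dimensional Gaussian laws.
    Complex exponents are avoided as well: the real Laplace transforms of both laws are finite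
    everywhere, so the cosine and sine series can be integrated term by term under the envelope e^z
    + e^-z. Going from cosines to half-spaces, and from these to an arbitrary event on K, alternates
    products and limits of test functions, so the class of admissible functions has to be stable
    under both. On the side of the walk, a last visit exists only if K is visited finitely often; by
    Borel-Cantelli it suffices that the Green function is finite on K, and this is read off from the
    field, whose covariances are real numbers. *)

Lemma normr_exprn_le_expR (R : realType) (k : nat) (y : R) :
  `|y| ^+ k <= k`!%:R * expR `|y|.
Proof.
case: k => [|k]; first by rewrite expr0 mul1r -expR0 ler_expR.
have f0 : 0 < k.+1`!%:R :> R by rewrite ltr0n fact_gt0.
have := expR_ge1Dxn k (normr_ge0 y); rewrite -ler_pdivrMl// mulrC => h.
by apply: le_trans h; rewrite lerDr.
Qed.

Lemma expR_norm_le (R : realType) (y : R) : expR `|y| <= expR y + expR (- y).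
Proof. by case: (ger0P y) => _; rewrite ?lerDl ?lerDr expR_ge0. Qed.

Lemma is_derive_MexpR (R : realType) (c : R) (f : R -> R) (s df : R) :
  is_derive s 1 f df ->
  is_derive s 1 (fun s : R => c * expR (f s)) (c * (df * expR (f s))).
Proof.
move=> h; rewrite (mulrC df).
exact: (is_deriveZ c (@is_derive1_comp _ expR f s _ _ (is_derive_expR (f s)) h)).
Qed.

Lemma is_derive_mulrr (R : realType) (b s : R) :
  is_derive s 1 (fun s : R => s * b) b.
Proof. by apply: is_derive_eq; rewrite scaler0 add0r; exact: mulr1. Qed.

(** * Exponential moments and differentiation under the integral *)

Section exponential_moments.
Context d (T : measurableType d) (R : realType) (P : {measure set T -> \bar R}).
Variables (w Z : T -> R).
Hypothesis mZ : measurable_fun setT Z.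
Hypothesis intw : forall r,
  P.-integrable setT (EFin \o (fun x => w x * expR (r * Z x))).

Let mw : measurable_fun setT w.
Proof.
have := measurable_int P (intw 0); move/measurable_EFinP.
by apply: eq_measurable_fun => x _; rewrite mul0r expR0 mulr1.
Qed.

Let mexp r : measurable_fun setT (fun x => expR (r * Z x)).
Proof. by apply: measurableT_comp => //; exact: measurable_funM. Qed.

(** The power costs one unit of exponential rate, by |x|^k <= k! e^|x|. Trading e^(c|x|) for two
    exponentials gives an envelope that [intw] makes integrable and that serves all [r] in a bounded
    interval at once. *)
Lemma exp_moment_bound (k : nat) (r c x : R) : `|r| + 1 <= c ->
  `|x ^+ k * expR (r * x)| <= k`!%:R * (expR (c * x) + expR (- c * x)).
Proof.
move=> rc; rewrite normrM normrX (ger0_norm (expR_ge0 _)).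
have c0 : 0 <= c by apply: le_trans rc; rewrite addr_ge0.
apply: (@le_trans _ _ (k`!%:R * expR `|c * x|)); last first.
  by rewrite ler_wpM2l// mulNr expR_norm_le.
apply: (@le_trans _ _ (k`!%:R * expR `|x| * expR (r * x))).
  by rewrite ler_wpM2r ?expR_ge0// normr_exprn_le_expR.
rewrite -mulrA ler_wpM2l// -expRD ler_expR normrM (ger0_norm c0).
apply: (le_trans (lerD (lexx _) (ler_norm _))); rewrite normrM.
by rewrite -[X in X + _]mul1r -mulrDl ler_wpM2r// addrC.
Qed.

Let intG (k : nat) (c : R) : P.-integrable setT
  (EFin \o (fun x => `|w x| * (k`!%:R * (expR (c * Z x) + expR (- c * Z x))))).
Proof.
have := integrableZl measurableT k`!%:R
  (integrableD measurableT (integrable_norm (intw c)) (integrable_norm (intw (- c)))).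
apply: eq_integrable => // x _ /=.
rewrite !normrM !(ger0_norm (expR_ge0 _)) -EFinD -EFinM; congr EFin.
by rewrite -mulrDr mulrCA.
Qed.

Lemma exp_moment_integrable (k : nat) (r : R) :
  P.-integrable setT (EFin \o (fun x => w x * (Z x ^+ k * expR (r * Z x)))).
Proof.
apply: le_integrable (intG k (`|r| + 1)) => //.
  apply/measurable_EFinP; apply: measurable_funM => //.
  by apply: measurable_funM => //; exact: measurable_funX.
move=> x _ /=; rewrite lee_fin normrM [leRHS]normrM normr_id ler_wpM2l//.
by rewrite (le_trans (exp_moment_bound _ _ (lexx _)))// ler_norm.
Qed.

Lemma exp_moment_derive (k : nat) (r : R) :
  is_derive r 1
    (fun r => \int[P]_x (w x * (Z x ^+ k * expR (r * Z x))))
    (\int[P]_x (w x * (Z x ^+ k.+1 * expR (r * Z x)))).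
Proof.
pose f (r : R) x := w x * (Z x ^+ k * expR (r * Z x)).
have df (s : R) x : is_derive s 1 (f ^~ x) (w x * (Z x ^+ k.+1 * expR (s * Z x))).
  have := is_derive_MexpR (w x * Z x ^+ k) (is_derive_mulrr (Z x) s).
  rewrite mulrA -(mulrA (w x)) -exprSr -mulrA.
  by apply: near_eq_is_derive; near=> y; rewrite /f mulrA.
have d1fE (s : R) x : partial1of2 f s x = w x * (Z x ^+ k.+1 * expR (s * Z x)).
  by rewrite partial1of2E; have := df s x => -[_ ->].
(* For [s] in []r - 1, r + 1[] one has |s| <= |r| + 1; the second unit in |r| + 2 pays for the power
   [k.+1]. *)
pose G x := `|w x| * (k.+1`!%:R * (expR ((`|r| + 2) * Z x) + expR (- (`|r| + 2) * Z x))).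
have rI : [set` `]r - 1, r + 1[] r by rewrite /= in_itv/=; apply/andP; split; lra.
have H1 (s : R) : [set` `]r - 1, r + 1[] s -> P.-integrable setT (EFin \o f s).
  by move=> _; exact: exp_moment_integrable.
have H2 (s : R) x : [set` `]r - 1, r + 1[] s -> setT x -> derivable (f ^~ x) s 1.
  by move=> _ _; have := df s x => -[].
have H3 x : 0 <= G x by rewrite mulr_ge0// mulr_ge0// addr_ge0// expR_ge0.
have H4 : P.-integrable setT (EFin \o G) by exact: intG.
have H5 (s : R) x : [set` `]r - 1, r + 1[] s -> setT x -> `|partial1of2 f s x| <= G x.
  rewrite /= in_itv/= => /andP[rs sr] _; rewrite d1fE normrM ler_wpM2l//.
  apply: exp_moment_bound.
  have -> : s = (s - r) + r by rewrite subrK.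
  rewrite -[X in _ + X <= _]/1 (_ : 2 = 1 + 1 :> R)//.
  apply: (@le_trans _ _ (`|s - r| + `|r| + 1)); first by rewrite lerD2r ler_normD.
  by have : `|s - r| <= 1 by [rewrite ler_norml; apply/andP; split; lra]; lra.
apply: DeriveDef; first exact:
  (@derivable_under_integral _ _ _ P f setT measurableT r _ _ rI H1 H2 G H3 H4 H5).
rewrite -derive1E
  (@differentiation_under_integral _ _ _ P f setT measurableT r _ _ rI H1 H2 G H3 H4 H5).
by apply: eq_Rintegral => x _; exact: d1fE.
Unshelve. all: by end_near. Qed.

End exponential_moments.

Lemma dominated_Rintegral d (T : measurableType d) (R : realType)
    (P : {measure set T -> \bar R}) (f_ : nat -> T -> R) (f g : T -> R) :
  (forall n, P.-integrable setT (EFin \o f_ n)) ->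
  P.-integrable setT (EFin \o g) ->
  (forall n x, `|f_ n x| <= g x) ->
  (forall x, f_ n x @[n --> \oo] --> f x) ->
  P.-integrable setT (EFin \o f) /\
  (\int[P]_x f_ n x @[n --> \oo] --> \int[P]_x f x).
Proof.
move=> intf intg fg cf.
have mf_ n : measurable_fun setT (f_ n).
  exact/measurable_EFinP/(measurable_int P (intf n)).
have mf : measurable_fun setT f.
  by apply: measurable_fun_cvg => [n|x _]; [exact: mf_|exact: cf].
have [] := @dominated_convergence _ _ _ P setT measurableT
  (fun n => EFin \o f_ n) (EFin \o f) (EFin \o g).
- by move=> n; exact/measurable_EFinP.
- exact/measurable_EFinP.
- by apply/aeW => x _; apply: cvg_EFin; [exact: nearW|exact: cf].
- exact: intg.
- by apply/aeW => x n _; rewrite lee_fin.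
move=> intfl _ c; split => //.
apply/fine_cvg; rewrite fineK; first exact: c.
exact: integrable_fin_num.
Qed.

(** The cosine and sine series both have coefficients at most 1/k! in absolute value, so this single
    bound, uniform in [n], dominates the partial sums of either. *)
Lemma series_power_bound (R : realType) (c : nat -> R) (z : R) (n : nat) :
  (forall k, `|c k| <= k`!%:R^-1) ->
  `|series (fun k => c k * z ^+ k) n| <= expR `|z|.
Proof.
move=> hc; apply: (@le_trans _ _ (series (exp_coeff `|z|) n)).
  rewrite /series/= (le_trans (ler_norm_sum _ _ _))//; apply: ler_sum => k _.
  by rewrite /exp_coeff/= normrM normrX mulrC ler_wpM2l.
apply: nondecreasing_cvgn_le; last exact: is_cvg_series_exp_coeff.
apply/nondecreasing_seqP => k.
by rewrite /series/= big_nat_recr//= lerDl exp_coeff_ge0.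
Qed.

(** * Two weighted laws with the same Laplace transform *)

Definition dot (R : realType) (I : finType) (a u : I -> R) : R := \sum_i a i * u i.

Lemma dotD (R : realType) (I : finType) (a b u : I -> R) :
  dot (fun i => a i + b i) u = dot a u + dot b u.
Proof. by rewrite /dot -big_split; apply: eq_bigr => i _; rewrite mulrDl. Qed.

Lemma dotZ (R : realType) (I : finType) (r : R) (a u : I -> R) :
  dot (fun i => r * a i) u = r * dot a u.
Proof. by rewrite /dot mulr_sumr; apply: eq_bigr => i _; rewrite mulrA. Qed.

Lemma measurable_dot d (T : measurableType d) (R : realType) (I : finType)
    (X : T -> I -> R) (a : I -> R) :
  (forall i, measurable_fun setT (X ^~ i)) ->
  measurable_fun setT (fun x => dot a (X x)).
Proof.
move=> mX; apply: measurable_sum => i.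
by apply: measurable_funM => //; exact: mX.
Qed.

(* The two laws on [I -> R] compared here are that of [X] with weight [v] and that
   of [Y] with weight [w]. *)
Section weighted_laws.
Context d (T : measurableType d) (R : realType) (P : {measure set T -> \bar R}).
Variables (I : finType) (X Y : T -> I -> R) (v w : T -> R).
Hypothesis mX : forall i, measurable_fun setT (X ^~ i).
Hypothesis mY : forall i, measurable_fun setT (Y ^~ i).

(** Integrability is recorded on both sides because [Rintegral] takes a default real value when the
    integral is infinite, so the equality alone would not survive sums and limits. *)
Definition agree (F : (I -> R) -> R) :=
  [/\ P.-integrable setT (EFin \o (fun x => v x * F (X x))),
      P.-integrable setT (EFin \o (fun x => w x * F (Y x))) &
      \int[P]_x (v x * F (X x)) = \int[P]_x (w x * F (Y x))].

Hypothesis agree_expR : forall a : I -> R, agree (fun u => expR (dot a u)).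

Lemma eq_agree F G : F =1 G -> agree F -> agree G.
Proof. by move=> /funext ->. Qed.

Lemma agreeD F G : agree F -> agree G -> agree (fun u => F u + G u).
Proof.
move=> [F1 F2 F3] [G1 G2 G3].
have e (z : T -> R) (Z : T -> I -> R) : (fun x => z x * (F (Z x) + G (Z x))) =
    (fun x => z x * F (Z x) + z x * G (Z x)) by apply/funext => x; rewrite mulrDr.
split; [rewrite e; exact: (integrableD measurableT F1 G1)
       |rewrite e; exact: (integrableD measurableT F2 G2)|].
by rewrite !e !RintegralD// F3 G3.
Qed.

Lemma agreeZ r F : agree F -> agree (fun u => r * F u).
Proof.
move=> [F1 F2 F3].
have e (z : T -> R) (Z : T -> I -> R) : (fun x => z x * (r * F (Z x))) =
    (fun x => r * (z x * F (Z x))) by apply/funext => x; rewrite mulrCA.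
split; [rewrite e; exact: (integrableZl measurableT r F1)
       |rewrite e; exact: (integrableZl measurableT r F2)|].
by rewrite !e !RintegralZl// F3.
Qed.

Lemma agree_sum (F_ : nat -> (I -> R) -> R) n :
  (forall k, agree (F_ k)) -> agree (fun u => \sum_(0 <= k < n) F_ k u).
Proof.
move=> h; elim: n => [|n ih].
  apply: eq_agree (agreeZ 0 (h 0%N)) => u.
  by rewrite mul0r big_geq.
by apply: eq_agree (agreeD ih (h n)) => u; rewrite big_nat_recr.
Qed.

Lemma agree_lim (F_ : nat -> (I -> R) -> R) F G :
  (forall n, agree (F_ n)) -> agree G -> (forall n u, `|F_ n u| <= G u) ->
  (forall u, F_ n u @[n --> \oo] --> F u) -> agree F.
Proof.
move=> aF [G1 G2 _] FG cF.
have lim (z : T -> R) (Z : T -> I -> R) :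
    (forall n, P.-integrable setT (EFin \o (fun x => z x * F_ n (Z x)))) ->
    P.-integrable setT (EFin \o (fun x => z x * G (Z x))) ->
    P.-integrable setT (EFin \o (fun x => z x * F (Z x))) /\
    (\int[P]_x (z x * F_ n (Z x)) @[n --> \oo] --> \int[P]_x (z x * F (Z x))).
  move=> intF intG; apply: (@dominated_Rintegral _ _ _ _ _ _ (fun x => `|z x * G (Z x)|)) => //.
  - exact: integrable_norm intG.
  - by move=> n x; rewrite normrM [leRHS]normrM ler_wpM2l// (le_trans (FG _ _))// ler_norm.
  - by move=> x; apply: cvgMr; exact: cF.
have [//|i1 c1] := lim v X _ G1; first by move=> n; have [] := aF n.
have [//|i2 c2] := lim w Y _ G2; first by move=> n; have [] := aF n.
split => //.
have e : (fun n => \int[P]_x (v x * F_ n (X x))) = (fun n => \int[P]_x (w x * F_ n (Y x))).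
  by apply/funext => n; have [] := aF n.
by rewrite e in c1; exact: cvg_unique c1 c2.
Qed.

(** Along the line through [a] both Laplace transforms are the same function of [r], hence so are
    all their derivatives. The induction carries every [r], not only the value wanted later, because
    the equality of functions is what gets differentiated. *)
Lemma agree_moment (a : I -> R) k r :
  agree (fun u => dot a u ^+ k * expR (r * dot a u)).
Proof.
have iv s : P.-integrable setT (EFin \o (fun x => v x * expR (s * dot a (X x)))).
  by have [+ _ _] := agree_expR (fun i => s * a i); under eq_fun do rewrite dotZ.
have iw s : P.-integrable setT (EFin \o (fun x => w x * expR (s * dot a (Y x)))).
  by have [_ + _] := agree_expR (fun i => s * a i); under eq_fun do rewrite dotZ.
have maX := measurable_dot a mX; have maY := measurable_dot a mY.
split; [exact: exp_moment_integrable|exact: exp_moment_integrable|].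
elim: k r => [|k ih] r.
  have e (z : T -> R) (Z : T -> I -> R) :
      \int[P]_x (z x * (dot a (Z x) ^+ 0 * expR (r * dot a (Z x)))) =
      \int[P]_x (z x * expR (dot (fun i => r * a i) (Z x))).
    by apply: eq_Rintegral => x _; rewrite expr0 mul1r dotZ.
  by rewrite !e; have [] := agree_expR (fun i => r * a i).
have [_ <-] := exp_moment_derive maX iv k r.
have [_ <-] := exp_moment_derive maY iw k r.
by congr ('D_1 _ r); apply/funext => s; exact: ih.
Qed.

(** Partial sums are combinations of the moments at [r = 0]. The envelope e^z + e^-z is integrable
    on both sides by the case [k = 0] of [agree_moment] at rates 1 and -1. *)
Lemma agree_power_series (c : nat -> R) (a : I -> R) (F : R -> R) :
  (forall k, `|c k| <= k`!%:R^-1) ->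
  (forall z, series (fun k => c k * z ^+ k) n @[n --> \oo] --> F z) ->
  agree (fun u => F (dot a u)).
Proof.
move=> hc cF.
apply: (@agree_lim (fun n u => series (fun k => c k * dot a u ^+ k) n) _
   (fun u => expR (1 * dot a u) + expR ((-1) * dot a u))).
- move=> n; apply: agree_sum => k; apply: agreeZ.
  by apply: eq_agree (agree_moment a k 0) => u; rewrite mul0r expR0 mulr1.
- by apply: agreeD; [have := agree_moment a 0 1|have := agree_moment a 0 (-1)];
    apply: eq_agree => u; rewrite expr0 mul1r.
- move=> n u; rewrite (le_trans (series_power_bound _ _ hc))//.
  by rewrite mul1r mulN1r expR_norm_le.
- by move=> u; exact: cF.
Qed.

(** The power series give the cosine and the sine of [dot a u]; the addition formula then brings in
    the phase. *)
Lemma agree_cos (a : I -> R) (b : R) : agree (fun u => cos (dot a u + b)).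
Proof.
have ac : agree (fun u => cos (dot a u)).
  apply: (@agree_power_series (fun n => (~~ odd n)%:R * (-1) ^+ n./2 * n`!%:R^-1)).
    move=> k; rewrite !normrM normrX normrN1 expr1n mulr1.
    rewrite (@ger0_norm _ k`!%:R^-1) ?invr_ge0//.
    by case: (odd k); rewrite /= ?normr0 ?normr1 ?mul0r ?mul1r.
  move=> z; have := @is_cvg_series_cos_coeff _ z; rewrite cosE cos_coeffE; exact.
have as_ : agree (fun u => sin (dot a u)).
  apply: (@agree_power_series (fun n => (odd n)%:R * (-1) ^+ n.-1./2 * n`!%:R^-1)).
    move=> k; rewrite !normrM normrX normrN1 expr1n mulr1.
    rewrite (@ger0_norm _ k`!%:R^-1) ?invr_ge0//.
    by case: (odd k); rewrite /= ?normr0 ?normr1 ?mul0r ?mul1r.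
  move=> z; have := @is_cvg_series_sin_coeff _ z; rewrite sinE sin_coeffE; exact.
apply: eq_agree (agreeD (agreeZ (cos b) ac) (agreeZ (- sin b) as_)) => u.
by rewrite cosD mulNr mulrC (mulrC (sin b)).
Qed.

(** * The algebra of multipliers, from cosines to level events *)

Definition bounded_test (F : (I -> R) -> R) := exists C, forall u, `|F u| <= C.

(** The phase [b] puts the sines into the family, which makes it stable under products up to linear
    combinations. Boundedness of [G] supplies the constant that dominates in limits. *)
Definition trig_agree (G : (I -> R) -> R) :=
  bounded_test G /\ forall a b, agree (fun u => G u * cos (dot a u + b)).

(* [multiplier] is an algebra closed under bounded pointwise limits by its very
   shape, which spares an induction on trigonometric polynomials. *)
Definition multiplier (F : (I -> R) -> R) :=
  bounded_test F /\
  forall G, trig_agree G -> trig_agree (fun u => F u * G u).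

(** Test the multiplier on [G = 1] with [a = 0] and [b = 0], where the cosine is 1. *)
Lemma multiplier_agree F : multiplier F -> agree F.
Proof.
have t1 : trig_agree (fun=> 1).
  split; first by exists 1 => u; rewrite normr1.
  by move=> a b; apply: eq_agree (agree_cos a b) => u; rewrite mul1r.
move=> [_ /(_ _ t1)[_ /(_ (fun=> 0) 0)]]; apply: eq_agree => u.
by rewrite addr0 -[fun=> 0](_ : (fun i => 0 * 0) = _) ?dotZ ?mul0r ?cos0 ?mulr1//;
  apply/funext => i; rewrite mul0r.
Qed.

Lemma eq_multiplier F G : F =1 G -> multiplier F -> multiplier G.
Proof. by move=> /funext ->. Qed.

Lemma multiplier_cst r : multiplier (fun=> r).
Proof.
split; first by exists `|r|.
move=> G [[C GC] hG]; split.
  by exists (`|r| * C) => u; rewrite normrM ler_wpM2l.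
by move=> a b; apply: eq_agree (agreeZ r (hG a b)) => u; rewrite mulrA.
Qed.

Lemma multiplierD F G : multiplier F -> multiplier G ->
  multiplier (fun u => F u + G u).
Proof.
have bD H K : bounded_test H -> bounded_test K ->
    bounded_test (fun u => H u + K u).
  move=> [C hC] [D hD]; exists (C + D) => u.
  by rewrite (le_trans (ler_normD _ _))// lerD.
move=> [bF hF] [bG hG]; split; first exact: bD.
move=> H tH; have [bF' hF'] := hF _ tH; have [bG' hG'] := hG _ tH; split.
  by have [C hC] := bD _ _ bF' bG'; exists C => u; rewrite mulrDl.
move=> a b; apply: eq_agree (agreeD (hF' a b) (hG' a b)) => u.
by rewrite !mulrDl.
Qed.

Lemma multiplierM F G : multiplier F -> multiplier G ->
  multiplier (fun u => F u * G u).
Proof.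
move=> [[C hC] hF] [[D hD] hG]; split.
  by exists (C * D) => u; rewrite normrM ler_pM.
move=> H /hG/hF; congr trig_agree; apply/funext => u; exact: mulrA.
Qed.

Lemma multiplierB F G : multiplier F -> multiplier G ->
  multiplier (fun u => F u - G u).
Proof.
move=> hF hG; apply: eq_multiplier (multiplierD hF (multiplierM (multiplier_cst (-1)) hG)).
by move=> u; rewrite mulN1r.
Qed.

Lemma multiplier_prod (J : Type) (s : seq J) (F : J -> (I -> R) -> R) :
  (forall j, multiplier (F j)) -> multiplier (fun u => \prod_(j <- s) F j u).
Proof.
move=> h; elim: s => [|j s ih].
  by apply: eq_multiplier (multiplier_cst 1) => u; rewrite big_nil.
by apply: eq_multiplier (multiplierM (h j) ih) => u; rewrite big_cons.
Qed.

Lemma multiplier_sum (J : Type) (s : seq J) (F : J -> (I -> R) -> R) :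
  (forall j, multiplier (F j)) -> multiplier (fun u => \sum_(j <- s) F j u).
Proof.
move=> h; elim: s => [|j s ih].
  by apply: eq_multiplier (multiplier_cst 0) => u; rewrite big_nil.
by apply: eq_multiplier (multiplierD (h j) ih) => u; rewrite big_cons.
Qed.

(** Product-to-sum: cos p cos q is half of cos (p + q) + cos (p - q), and both terms belong to the
    family on which [trig_agree] tests [G]. *)
Lemma multiplier_cos (a : I -> R) (b : R) :
  multiplier (fun u => cos (dot a u + b)).
Proof.
split; first by exists 1 => u; rewrite cos_max.
move=> G [[C GC] hG]; split.
  by exists (1 * C) => u; rewrite normrM ler_pM// cos_max.
move=> a' b'.
have := agreeZ 2^-1 (agreeD (hG (fun i => a i + a' i) (b + b'))
                           (hG (fun i => a i + -1 * a' i) (b - b'))).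
apply: eq_agree => u; rewrite !dotD dotZ mulN1r.
rewrite (_ : dot a u + dot a' u + (b + b') = (dot a u + b) + (dot a' u + b')); last by ring.
rewrite (_ : dot a u - dot a' u + (b - b') = (dot a u + b) - (dot a' u + b')); last by ring.
by rewrite cosD cosB; field.
Qed.

(** With [G] bounded by [D] and the cosine by 1, the constant [C * D] dominates; constants are
    multipliers, which makes it integrable under both weights. *)
Lemma multiplier_lim (F_ : nat -> (I -> R) -> R) F C :
  (forall n, multiplier (F_ n)) -> (forall n u, `|F_ n u| <= C) ->
  (forall u, F_ n u @[n --> \oo] --> F u) -> multiplier F.
Proof.
move=> hF FC cF.
have bF u : `|F u| <= C.
  by apply: (cvgr_to_le (cvg_norm (cF u))); exact: nearW.
split; first by exists C.
move=> G tG; have [[D GD] hG] := tG; split.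
  by exists (C * D) => u; rewrite normrM ler_pM.
move=> a b; apply: (@agree_lim (fun n u => F_ n u * G u * cos (dot a u + b)) _ (fun=> C * D)).
- by move=> n; have [_ /(_ _ tG)[]] := hF n.
- by apply: multiplier_agree; exact: multiplier_cst.
- move=> n u; rewrite normrM normrM -[leRHS]mulr1.
  by rewrite ler_pM ?mulr_ge0 ?cos_max// ler_pM.
- by move=> u; apply: cvgMl; apply: cvgMl; exact: cF.
Qed.

(* The odd polynomial [y (3 - y^2) / 2] maps [-1, 1] to itself and its iterates
   converge there to the sign. *)
Let smooth (y : R) := y * (3 - y ^+ 2) / 2.

Lemma smooth_iter_norm (y : R) n : `|y| <= 1 -> `|iter n smooth y| <= 1.
Proof.
move=> y1; elim: n => //= n; set z := iter n smooth y => z1.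
move: z1; rewrite !ler_norml => /andP[z1 z2].
(* [smooth] takes the values 1 and -1 at 1 and -1 with zero derivative, hence the squared factors;
   the remaining linear factors are positive on [-1, 1]. *)
have e1 : 1 - smooth z = (1 - z) ^+ 2 * (2 + z) / 2 by rewrite /smooth; field.
have e2 : smooth z - -1 = (1 + z) ^+ 2 * (2 - z) / 2 by rewrite /smooth; field.
by apply/andP; split; rewrite -subr_ge0 ?e1 ?e2 !mulr_ge0 ?sqr_ge0//; lra.
Qed.

Lemma smooth_iterN (y : R) n : iter n smooth (- y) = - iter n smooth y.
Proof. by elim: n => //= n ->; rewrite /smooth sqrrN !mulNr. Qed.

(** On (0, 1] one step multiplies the distance to 1 by 1 - z (1 + z) / 2. Since the iterates never
    fall below the starting point [y], this factor is at most 1 - y / 2, a geometric rate. *)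
Lemma smooth_iter_gt0 (y : R) n : 0 < y <= 1 ->
  y <= iter n smooth y <= 1 /\ 1 - iter n smooth y <= (1 - y / 2) ^+ n.
Proof.
move=> /andP[y0 y1]; elim: n => /= [|n]; first by rewrite expr0 lexx y1; split => //; lra.
set z := iter n smooth y => -[/andP[yz z1] ih].
have -> : smooth z = z + z * (1 - z ^+ 2) / 2 by rewrite /smooth; field.
have z0 : 0 < z by apply: lt_le_trans yz.
have e : 1 - (z + z * (1 - z ^+ 2) / 2) = (1 - z) * (1 - z * (1 + z) / 2) by field.
have z2 : z ^+ 2 <= 1 by rewrite expr_le1// ltW.
have z3 : 0 <= z * (1 - z ^+ 2) by rewrite mulr_ge0 ?subr_ge0// ltW.
split.
  apply/andP; split; first by lra.
  by rewrite -subr_ge0 e mulr_ge0 ?subr_ge0//; nra.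
rewrite e exprSr ler_pM ?subr_ge0//; nra.
Qed.

Lemma smooth_iter_sg (y : R) : `|y| <= 1 ->
  iter n smooth y @[n --> \oo] --> Num.sg y.
Proof.
have pos z : 0 < z <= 1 -> iter n smooth z @[n --> \oo] --> (1 : R).
  move=> z01; have /andP[z0 z1] := z01.
  apply/subr_cvg0; apply: norm_cvg0.
  apply: (@squeeze_cvgr _ _ _ _ (cst 0) (fun n => (1 - z / 2) ^+ n)).
  - apply: nearW => n; rewrite /= normr_ge0/= distrC ger0_norm.
      by have [] := smooth_iter_gt0 n z01.
    by have [/andP[]] := smooth_iter_gt0 n z01; rewrite subr_ge0.
  - exact: cvg_cst.
  - by apply: cvg_expr; rewrite ger0_norm; lra.
move=> /[!ler_norml]/andP[y1 y2]; have [->|y0|y0] := sgrP y.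
- rewrite (_ : (fun n => _) = cst 0); first exact: cvg_cst.
  by apply/funext; elim=> //= n ->; rewrite /smooth /cst !mul0r.
- by apply: pos; rewrite y0.
- rewrite (_ : (fun n => _) = (fun n => - iter n smooth (- y))).
    by apply: cvgN; apply: pos; rewrite oppr_gt0; lra.
  by apply/funext => n; rewrite smooth_iterN opprK.
Qed.

(** Each iterate of [smooth] is a polynomial in [F], hence a multiplier, and all of them stay within
    [-1, 1]. *)
Lemma multiplier_sg F : (forall u, `|F u| <= 1) -> multiplier F ->
  multiplier (fun u => Num.sg (F u)).
Proof.
move=> F1 hF; apply: (@multiplier_lim (fun n u => iter n smooth (F u)) _ 1).
- elim=> //= n ih; apply: multiplierM (multiplier_cst _).
  apply: multiplierM => //; apply: multiplierB; first exact: multiplier_cst.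
  by apply: eq_multiplier (multiplierM ih ih) => u; rewrite expr2.
- by move=> n u; exact: smooth_iter_norm.
- by move=> u; exact: smooth_iter_sg.
Qed.

(** A coordinate is unbounded, so it cannot itself be a multiplier, but sines of it can. Once |z| <
    n + 1 the argument lies in (-1, 1), where the sine has the sign of its argument, so the sequence
    is eventually constant. *)
Lemma sg_sin_small (z : R) :
  Num.sg (sin (z / n.+1%:R)) @[n --> \oo] --> Num.sg z.
Proof.
suff : \forall n \near \oo, Num.sg (sin (z / n.+1%:R)) = Num.sg z.
  by move=> h; exact: cvg_near_cst h.
near=> n.
have n0 : 0 < n.+1%:R :> R by rewrite ltr0n.
have zn : `|z| / n.+1%:R < 1.
  rewrite ltr_pdivrMr// mul1r (@lt_le_trans _ _ n%:R)//; last by rewrite ler_nat.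
  by near: n; exact: nbhs_infty_gtr.
have pi1 : 1 < pi :> R by have := @pi_ge2 R; lra.
have pos (t : R) : 0 < t -> `|t| / n.+1%:R < 1 -> Num.sg (sin (t / n.+1%:R)) = 1.
  move=> t0; rewrite gtr0_norm// => tn; rewrite gtr0_sg// sin_gt0_pi//.
  by rewrite divr_gt0//= (lt_trans tn pi1).
have [->|z0|z0] := sgrP z.
- by rewrite mul0r sin0 sgr0.
- exact: pos.
- by rewrite -[z]opprK mulNr sinN sgrN pos// ?normrN// oppr_gt0.
Unshelve. all: by end_near. Qed.

Lemma multiplier_coord_ge (i : I) (h : R) :
  multiplier (fun u => (h <= u i)%R%:R).
Proof.
have hs : multiplier (fun u => Num.sg (h - u i)).
  apply: (@multiplier_lim (fun n u => Num.sg (sin ((h - u i) / n.+1%:R))) _ 1).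
  - move=> n; apply: multiplier_sg => [u|]; first exact: sin_max.
    (* This choice gives [dot a u] = - u i / (n + 1); the phase shift by pi / 2 turns the cosine
       into the required sine. *)
    pose a j : R := (j == i)%:R * - n.+1%:R^-1.
    apply: eq_multiplier (multiplier_cos a (h / n.+1%:R - pi / 2)) => u.
    rewrite addrA cosBpihalf; congr sin.
    rewrite /dot (bigD1 i)//= big1 => [|j ji]; last by rewrite /a (negbTE ji) !mul0r.
    by rewrite /a eqxx mul1r addr0 mulNr mulrC addrC -mulrBl.
  - by move=> n u; rewrite normr_sg; case: (_ == _).
  - by move=> u; exact: sg_sin_small.
(* For s the sign of [h - u i], the indicator is 1 - (s + s^2) / 2. It is 1 at s = 0 as well as at s
   = -1, so the threshold is closed. *)
apply: eq_multiplier (multiplierB (multiplier_cst 1)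
  (multiplierM (multiplier_cst 2^-1) (multiplierD hs (multiplierM hs hs)))) => u.
have [h0|h0|h0] := ltgtP h (u i).
- by rewrite ltr0_sg ?subr_lt0//= mulN1r opprK addNr mulr0 subr0.
- by rewrite gtr0_sg ?subr_gt0//= mulr1 mulVf ?subrr.
- by rewrite h0 subrr sgr0 /= mul0r addr0 mulr0 subr0.
Qed.

Lemma agree_level (A : {set {ffun I -> bool}}) (h : R) :
  agree (fun u => ([ffun i => (h <= u i)%R] \in A)%:R).
Proof.
apply: multiplier_agree.
pose F (e : {ffun I -> bool}) (u : I -> R) : R :=
  (e \in A)%:R * \prod_i (if e i then (h <= u i)%R%:R else 1 - (h <= u i)%R%:R).
apply: (@eq_multiplier (fun u => \sum_e F e u)); last first.
  apply: multiplier_sum => e; apply: multiplierM; first exact: multiplier_cst.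
  apply: multiplier_prod => i; case: (e i); first exact: multiplier_coord_ge.
  by apply: multiplierB; [exact: multiplier_cst|exact: multiplier_coord_ge].
(* Exactly one pattern [e] matches [u]: any other one differs at some coordinate, where its product
   has a zero factor. *)
move=> u; rewrite (bigD1 [ffun i => (h <= u i)%R])//= big1 ?addr0 => [|e eu].
  rewrite /F big1 ?mulr1// => i _; rewrite ffunE.
  by case: (h <= u i); rewrite ?subr0.
have [i ei] : exists i, e i != (h <= u i).
  apply/existsP; apply: contraNT eu; rewrite negb_exists => /forallP ne.
  by apply/eqP/ffunP => i; rewrite ffunE; apply/eqP; have := ne i; rewrite negbK.
rewrite /F (bigD1 i)//=; case: (e i) ei; case: (h <= u i) => //= _;
  by rewrite ?subrr mul0r mulr0.
Qed.

End weighted_laws.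

(** * The killed walk: measurability of path events and the Markov property *)

Lemma step_prob_ge0 (R : realType) (d : nat) (G : ambient) (theta : R)
    (u v : option (vertex d G)) :
  0 <= theta <= 1 -> 0 <= step_prob theta u v.
Proof.
move=> /andP[t0 t1]; case: u v => [y|] [z|] //=.
have c0 : 0 <= (1 - theta) / (2 * d)%:R by rewrite divr_ge0// subr_ge0.
by apply: sumr_ge0 => i _; rewrite addr_ge0// mulr_ge0.
Qed.

Section path_measurability.
Context (d : nat) (G : ambient).
Local Notation state := (option (vertex d G)).
Local Notation path := (path_space d G).

Lemma measurable_coord_eq n (u : state) : measurable [set w : path | w n = u].
Proof. by apply: sub_sigma_algebra; exists n, u. Qed.

(** Indexing by codes in [nat] gives the countable partition by states the form that
    sigma-additivity asks for. *)
Lemma coord_partition n (A : set path) :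
  A = \bigcup_i (if @pickle_inv state i is Some v
                 then A `&` [set w | w n = v] else set0).
Proof.
apply/seteqP; split => [w Aw|w [i _]].
  by exists (choice.pickle (w n)) => //; rewrite pickleK_inv.
by case: pickle_inv => // v -[].
Qed.

Lemma measurable_coord n (A : set state) : measurable [set w : path | A (w n)].
Proof.
rewrite (coord_partition n [set w : path | A (w n)]).
apply: bigcupT_measurable => i; case: pickle_inv => // v.
have [Av|nAv] := pselect (A v).
  rewrite (_ : _ `&` _ = [set w : path | w n = v]); first exact: measurable_coord_eq.
  by apply/seteqP; split => w /= => [[]//|wv]; rewrite wv.
rewrite (_ : _ `&` _ = set0) //.
by apply/seteqP; split => w //= [+ wv]; rewrite wv.
Qed.

Lemma measure_coord_partition (R : realType) (mu : {measure set path -> \bar R})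
    n (A : set path) : measurable A ->
  mu A = (\sum_(i <oo) if @pickle_inv state i is Some v
                       then mu (A `&` [set w | w n = v]) else 0)%E.
Proof.
move=> mA; rewrite {1}(coord_partition n A) measure_bigcup.
- rewrite [LHS]eseries_mkcond; apply: eq_eseriesr => i _.
  by rewrite in_setT; case: pickle_inv.
- move=> i _; case: pickle_inv => // v; apply: measurableI => //.
  exact: measurable_coord_eq.
- apply/trivIsetP => i j _ _ ij; apply/seteqP; split => // w [].
  case: (@pickle_inv state i) (@pickle_invK state i) => //= v vi [_ wv].
  case: (@pickle_inv state j) (@pickle_invK state j) => //= v' vj [_ wv'].
  by move: ij; rewrite -vi -vj -wv -wv' eqxx.
Qed.

End path_measurability.

Section escape.
Context (R : realType) (d : nat) (G : ambient) (theta : R) (K : {fset vertex d G}).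
Hypothesis theta01 : 0 <= theta <= 1.
Local Notation state := (option (vertex d G)).
Local Notation path := (path_space d G).

Definition in_set_state (u : state) : bool := if u is Some y then y \in K else false.

Definition prefix_event (n : nat) (s : trajectory d G) : set path :=
  [set w | forall k, (k <= n)%N -> w k = s k].

Definition avoid (n k : nat) : set path :=
  [set w | forall m, (n < m <= n + k)%N -> ~~ in_set_state (w m)].

(* The sum over the states is indexed by their codes, [pickle_inv] being [None] on
   the junk codes. *)
Fixpoint escape (k : nat) (u : state) : \bar R :=
  if k is j.+1 then
    (\sum_(i <oo) if @pickle_inv state i is Some v then
       if in_set_state v then 0 else (step_prob theta u v)%:E * escape j v
     else 0)%E
  else 1%E.

Lemma escape_ge0 k u : (0 <= escape k u)%E.
Proof.
elim: k u => //= k ih u; apply: nneseries_ge0 => i _ _.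
case: pickle_inv => // v; case: ifP => // _.
by rewrite mule_ge0// lee_fin step_prob_ge0.
Qed.

Definition update (s : trajectory d G) (n : nat) (v : state) : trajectory d G :=
  fun m => if m == n then v else s m.

Lemma measurable_prefix_event n s : measurable (prefix_event n s).
Proof.
rewrite (_ : prefix_event n s =
    \bigcap_k [set w : path | (k <= n)%N -> w k = s k]); last first.
  by apply/seteqP; split => [w h k _ /h //|w h k]; exact: h.
apply: bigcapT_measurable => k.
exact: (measurable_coord k [set u | (k <= n)%N -> u = s k]).
Qed.

Lemma measurable_avoid n k : measurable (avoid n k).
Proof.
rewrite (_ : avoid n k =
    \bigcap_m [set w : path | (n < m <= n + k)%N -> ~~ in_set_state (w m)]).
  apply: bigcapT_measurable => m.
  exact: (measurable_coord m [set u | (n < m <= n + k)%N -> ~~ in_set_state u]).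
by apply/seteqP; split => [w h m _ /h //|w h m]; exact: h.
Qed.

Variable mu : probability path R.
Hypothesis markov_mu : forall (n : nat) (s : trajectory d G),
  mu (prefix_event n.+1 s) =
  (mu (prefix_event n s) * (step_prob theta (s n) (s n.+1))%:E)%E.

(** Splitting on the state at time [n.+1] lengthens the prefix by one step, where [markov_mu]
    applies; hence an induction on [k] over all [n] and [s]. *)
Lemma prefix_avoid k n s :
  mu (prefix_event n s `&` avoid n k) = (mu (prefix_event n s) * escape k (s n))%E.
Proof.
elim: k n s => [|k ih] n s.
  rewrite (_ : avoid n 0 = setT) ?setIT ?mule1//.
  by apply/seteqP; split => // w _ m; rewrite addn0 ltnNge => /andP[/negbTE ->].
have mI : measurable (prefix_event n s `&` avoid n k.+1).
  by apply: measurableI; [exact: measurable_prefix_event|exact: measurable_avoid].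
rewrite (measure_coord_partition mu n.+1 mI) /=.
have pfin : mu (prefix_event n s) \is a fin_num.
  by rewrite fin_num_measure//; exact: measurable_prefix_event.
rewrite -(fineK pfin) -nneseriesZl; last first.
  move=> i _; case: pickle_inv => // v; case: ifP => // _.
  by rewrite mule_ge0 ?escape_ge0// lee_fin step_prob_ge0.
apply: eq_eseriesr => i _; rewrite fineK//.
case: pickle_inv => [v|]; last by rewrite mule0.
(* A state in K at time [n.+1] contradicts avoidance, which matches the zero term in [escape]. *)
case: ifPn => [Kv|Kv].
  rewrite mule0 (_ : _ `&` _ = set0) ?measure0//.
  apply/seteqP; split => // w [[_ /(_ n.+1)]] + /= wv.
  by rewrite wv Kv ltnS leqnn addnS ltnS leq_addr => /(_ isT).
have un : update s n.+1 v n = s n by rewrite /update ltn_eqF.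
have us : update s n.+1 v n.+1 = v by rewrite /update eqxx.
have updE m : (m <= n)%N -> update s n.+1 v m = s m by move=> mn; rewrite /update ltn_eqF.
have pE : prefix_event n (update s n.+1 v) = prefix_event n s.
  by apply/seteqP; split => w h m mn; rewrite (h m mn) updE.
transitivity (mu (prefix_event n.+1 (update s n.+1 v) `&` avoid n.+1 k)).
  congr (mu _); apply/seteqP; split => w.
    move=> [[wp wa] /= wv]; split => [m|m /andP[m1 m2]].
      by rewrite leq_eqVlt ltnS => /predU1P[->|mn]; rewrite ?us// -pE in wp *; exact: wp.
    by apply: wa; rewrite addnS -addSn m2 andbT (leq_trans _ m1).
  move=> [wp wa]; have wv : w n.+1 = v by rewrite wp.
  split => //; split => [|m /andP[m1 m2]].
    by rewrite -pE => m mn; apply: wp; rewrite (leq_trans mn).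
  move: m1; rewrite leq_eqVlt => /predU1P[<-|m1]; first by rewrite wv.
  by apply: wa; rewrite m1 addSn -addnS.
by rewrite ih markov_mu un us pE muleA.
Qed.

(* The law of the walk is only given on prefixes: the times before [n] are
   released one by one, from the last to the first. *)
Let slice n j s (u : state) : set path :=
  [set w | (forall k, (k < j)%N -> w k = s k) /\ w n = u].

Let slice_avoid n k u i s : escape k u \is a fin_num -> (i <= n)%N ->
  mu (slice n (n - i) s u `&` avoid n k) = (mu (slice n (n - i) s u) * escape k u)%E.
Proof.
move=> efin; elim: i s => [|i ih] s le_in.
  rewrite subn0 (_ : slice n n s u = prefix_event n (update s n u)).
    by rewrite prefix_avoid /update eqxx.
  apply/seteqP; split => w.
    move=> [h wn] m; rewrite leq_eqVlt /update => /predU1P[->|mn]; first by rewrite eqxx.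
    by rewrite ltn_eqF// h.
  move=> h; split => [m mn|]; last by rewrite h// /update eqxx.
  by rewrite h ?(ltnW mn)// /update ltn_eqF.
pose j := (n - i.+1)%N.
have jS : (n - i = j.+1)%N by rewrite /j subnSK.
have jn : (j < n)%N by rewrite /j ltn_subrL/= (leq_ltn_trans _ le_in).
have ms : measurable (slice n j s u).
  rewrite (_ : slice n j s u = (\bigcap_k [set w : path | (k < j)%N -> w k = s k]) `&`
     [set w | w n = u]).
    apply: measurableI; last exact: measurable_coord_eq.
    apply: bigcapT_measurable => m.
    exact: (measurable_coord m [set u | (m < j)%N -> u = s m]).
  apply/seteqP; split => w /=; first by move=> [h ?]; split => // m _; exact: h.
  by move=> [h ?]; split => // m; exact: h.
have split_slice v : slice n j s u `&` [set w | w j = v] = slice n j.+1 (update s j v) u.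
  apply/seteqP; split => w /=.
    move=> [[h wn] wv]; split => // m; rewrite ltnS leq_eqVlt /update => /predU1P[->|mj].
      by rewrite eqxx.
    by rewrite ltn_eqF// h.
  move=> [h wn]; split; last by rewrite h// /update eqxx.
  by split => // m mj; rewrite h ?(leqW mj)// /update ltn_eqF.
rewrite -/j (measure_coord_partition mu j (measurableI _ _ ms (measurable_avoid n k))).
rewrite (measure_coord_partition mu j ms) muleC.
rewrite -(fineK efin) -nneseriesZl; last by move=> m _; case: pickle_inv.
apply: eq_eseriesr => m _; rewrite fineK//.
case: pickle_inv => [v|]; last by rewrite mule0.
by rewrite setIAC split_slice -jS muleC; apply: ih; exact: ltnW.
Qed.

Lemma coord_avoid n k u : escape k u \is a fin_num ->
  mu ([set w : path | w n = u] `&` avoid n k) =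
  (mu [set w : path | w n = u] * escape k u)%E.
Proof.
(* With all [n] earlier times released the reference trajectory no longer matters, so any one will
   do. *)
move=> efin; have := slice_avoid (fun=> None) efin (leqnn n).
rewrite subnn (_ : slice n 0 _ u = [set w : path | w n = u])//.
by apply/seteqP; split => w /= [].
Qed.

End escape.

Lemma probabilityI1 d (T : measurableType d) (R : realType)
    (mu : probability T R) (A B : set T) :
  measurable A -> measurable B -> mu B = 1%E -> mu (A `&` B) = mu A.
Proof.
move=> mA mB B1; rewrite [RHS](measureDI mu mA mB).
rewrite [X in (X + _)%E](_ : _ = 0%E) ?add0e//.
apply/eqP; rewrite eq_le measure_ge0 andbT.
rewrite (_ : 0%E = mu (~` B)).
  apply: le_measure; rewrite ?inE; [exact: measurableD|exact: measurableC|].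
  by move=> w [].
by rewrite probability_setC// B1 subee.
Qed.

(** * Last visit to K and the Green function *)

Section last_exit.
Context (R : realType) (d : nat) (G : ambient) (K : {fset vertex d G}).
Local Notation state := (option (vertex d G)).
Local Notation path := (path_space d G).

Definition hit (n : nat) : set path := [set w | in_set_state K (w n)].

Definition never_after (n : nat) : set path :=
  [set w | forall m, (n < m)%N -> ~~ in_set_state K (w m)].

Lemma measurable_hit n : measurable (hit n).
Proof. exact: (measurable_coord n [set u | in_set_state K u]). Qed.

Lemma never_afterE n : never_after n = \bigcap_k avoid K n k.
Proof.
apply/seteqP; split => [w h k _ m /andP[/h]//|w h m nm].
by apply: (h m I); rewrite nm leq_addl.
Qed.

Lemma measurable_never_after n : measurable (never_after n).
Proof. by rewrite never_afterE; apply: bigcapT_measurable => k; exact: measurable_avoid. Qed.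

Lemma return_time_infinite (w : path) :
  (return_time R K w = +oo%E) = never_after 0 w.
Proof.
rewrite propeqE; split=> [/ereal_inf_pinfty h m m0|h]; last first.
  rewrite /return_time (_ : image _ _ = set0) ?ereal_inf0//.
  apply/seteqP; split => // e [n [n0 [y yK wn]] _].
  by have := h n n0; rewrite wn /= yK.
apply/negP; case wm : (w m) => [y|]//= yK.
have /h // : [set n%:R%:E | n in [set n : nat | (1 <= n)%N /\
  exists2 y, y \in K & w n = Some y]] (m%:R%:E : \bar R).
by exists m => //; split => //; exists y.
Qed.

Lemma measure_hit (mu : probability path R) n (A : set path) : measurable A ->
  mu (A `&` hit n) = (\sum_(y <- K) mu ([set w | w n = Some y] `&` A))%E.
Proof.
move=> mA; rewrite (_ : A `&` hit n =
    \bigcup_(y in [set` K]) ([set w : path | w n = Some y] `&` A)).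
  rewrite fsbig_seq ?fset_uniq// measure_fin_bigcup//.
  - move=> y z _ _ [w [[wy _] [wz _]]]; by move: wy wz => /= -> [].
  - by move=> y _; apply: measurableI => //; exact: measurable_coord_eq.
apply/seteqP; split => w /=.
  by rewrite /hit /=; case wn : (w n) => [y|] [Aw]//= yK; exists y.
by move=> [y /= yK [wn Aw]]; split => //; rewrite /hit /= wn.
Qed.

Lemma cvg_avoid (mu : probability path R) n (A : set path) : measurable A ->
  mu (A `&` avoid K n k) @[k --> \oo] --> mu (A `&` never_after n).
Proof.
move=> mA; rewrite never_afterE.
rewrite (_ : A `&` \bigcap_k avoid K n k = \bigcap_k (A `&` avoid K n k)); last first.
  apply/seteqP; split => [w [Aw h] k _|w h]; first by split => //; exact: h.
  by split => [|k _]; [have [] := h 0%N I|have [] := h k I].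
apply: (nonincreasing_cvg_mu (F := fun k => A `&` avoid K n k)).
- by rewrite ltey_eq fin_num_measure//; apply: measurableI => //; exact: measurable_avoid.
- by move=> k; apply: measurableI => //; exact: measurable_avoid.
- by apply: bigcapT_measurable => k; apply: measurableI => //; exact: measurable_avoid.
- move=> i j ij; apply/subsetPset => w [Aw h]; split => // m /andP[nm mi].
  by apply: h; rewrite nm (leq_trans mi)// leq_add2l.
Qed.

(** Outside the limsup the visit times are bounded, and 0 is one of them, so there is a largest
    one. *)
Lemma hit0_cover : hit 0 `<=` (\bigcup_n (never_after n `&` hit n)) `|` lim_sup_set hit.
Proof.
move=> w w0; have [|] := pselect (lim_sup_set hit w); first by right.
move=> /existsNP[N /not_implyP[_ hN]]; left.
have bN n : in_set_state K (w n) -> (n <= N)%N.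
  by move=> wn; rewrite leqNgt; apply/negP => Nn; apply: hN; exists n => //=; exact: ltnW.
have [n wn max] := ex_maxnP (ex_intro _ 0%N w0) bN.
exists n => //; split => // m nm.
by apply/negP => /max; rewrite leqNgt nm.
Qed.

Context (theta : R) (P : vertex d G -> probability path R).
Hypothesis theta01 : 0 <= theta <= 1.
Hypothesis hP : forall x, is_killed_walk_law theta x (P x).

Lemma escapeE k y : escape theta K k (Some y) = P y (avoid K 0 k).
Proof.
have [h0 hm] := hP y.
have := prefix_avoid K theta01 (mu := P y) hm k 0 (fun=> Some y).
have -> : prefix_event 0 (fun=> Some y) = [set w : path | w 0%N = Some y].
  apply/seteqP; split => w /=; first by apply.
  by move=> h k'; rewrite leqn0 => /eqP ->.
rewrite h0 mul1e => <-.
rewrite setIC; apply: probabilityI1 h0; [exact: measurable_avoid|exact: measurable_coord_eq].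
Qed.

(** Both sides are limits, as the horizon [k] grows, of the identity [coord_avoid] for finitely many
    steps. *)
Lemma coord_never_after x n y :
  P x ([set w : path | w n = Some y] `&` never_after n) =
  (P x [set w : path | w n = Some y] * P y (never_after 0))%E.
Proof.
have mn : measurable [set w : path | w n = Some y] by exact: measurable_coord_eq.
have pfin : P x [set w : path | w n = Some y] \is a fin_num by rewrite fin_num_measure.
have c1 := @cvg_avoid (P x) n _ mn.
have := @cvg_avoid (P y) 0 _ measurableT.
rewrite setTI => /(cvgeZl pfin) c2.
rewrite (_ : (fun k => P x _) = (fun k => P x [set w : path | w n = Some y] *
   P y (setT `&` avoid K 0 k))%E) in c1; first exact: cvg_unique c1 c2.
apply/funext => k; rewrite setTI -escapeE.
have [_ hm] := hP x.
rewrite (coord_avoid theta01 hm)// escapeE fin_num_measure//; exact: measurable_avoid.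
Qed.

Lemma kappa_trE y : (kappa_tr P K y)%:E = P y (never_after 0).
Proof.
rewrite /kappa_tr fineK.
  by congr (P y _); apply/seteqP; split => w; rewrite /= return_time_infinite.
rewrite fin_num_measure//.
rewrite (_ : [set w | _] = never_after 0); first exact: measurable_never_after.
by apply/seteqP; split => w; rewrite /= return_time_infinite.
Qed.

Lemma sum_green_kappa x : x \in K ->
  (forall y, y \in K -> (green P x y < +oo)%E) ->
  (\sum_(y <- K) green P x y * (kappa_tr P K y)%:E = 1)%E.
Proof.
move=> xK gfin.
pose E n := never_after n `&` hit n.
have mE n : measurable (E n).
  by apply: measurableI; [exact: measurable_never_after|exact: measurable_hit].
have tE : trivIset setT E.
  have disj i j w : (i < j)%N -> E i w -> E j w -> False.
    by move=> ij [/(_ j ij) + _] [_]; rewrite /hit /= => /negP.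
  apply/trivIsetP => i j _ _; rewrite neq_ltn => /orP[ij|ji];
    apply/seteqP; split => // w [wi wj].
  - exact: disj ij wi wj.
  - exact: disj ji wj wi.
have hitE n : P x (hit n) = (\sum_(y <- K) P x [set w : path | w n = Some y])%E.
  rewrite -[hit n]setTI (measure_hit (P x) n measurableT).
  by apply: eq_bigr => y _; rewrite setIT.
have PE : P x (\bigcup_n E n) = (\sum_(y <- K) green P x y * (kappa_tr P K y)%:E)%E.
  rewrite measure_semi_bigcup//; last exact: bigcupT_measurable.
  transitivity (\sum_(n <oo) \sum_(y <- K)
      (kappa_tr P K y)%:E * P x [set w : path | w n = Some y])%E.
    apply: eq_eseriesr => n _.
    apply: etrans (measure_hit (P x) n (measurable_never_after n)) _.
    by apply: eq_bigr => y _; rewrite coord_never_after kappa_trE muleC.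
  have k0 y : (0 <= (kappa_tr P K y)%:E)%E by rewrite kappa_trE.
  rewrite nneseries_sum; last by move=> y n _; rewrite mule_ge0.
  by apply: eq_bigr => y _; rewrite nneseriesZl// muleC.
(* Borel-Cantelli: the expected number of visits to K is a finite sum of finite Green values. *)
have lim0 : P x (lim_sup_set hit) = 0%E.
  apply: lim_sup_set_cvg0; first by move=> n; exact: measurable_hit.
  rewrite (eq_eseriesr (g := fun n => \sum_(y <- K) P x [set w : path | w n = Some y])%E); last first.
    by move=> n _; exact: hitE.
  rewrite nneseries_sum// big_seq; apply: lte_sum_pinfty => y yK.
  exact: gfin.
have mlim : measurable (lim_sup_set hit).
  apply: bigcapT_measurable => n; apply: bigcup_measurable => j _; exact: measurable_hit.
(* The disjoint events [E n] have total probability at most 1. Conversely the walk starts in K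
   almost surely, and [hit0_cover] covers that start by the [E n] and a null set. *)
rewrite -PE; apply/eqP; rewrite eq_le probability_le1 ?andTb; last exact: bigcupT_measurable.
have [h0 _] := hP x.
rewrite -h0; apply: le_trans (_ : P x ((\bigcup_n E n) `|` lim_sup_set hit) <= _)%E.
  apply: le_measure; rewrite ?inE.
  - exact: measurable_coord_eq.
  - by apply: measurableU => //; exact: bigcupT_measurable.
  - by move=> w /= w0; apply: hit0_cover; rewrite /hit /= w0.
apply: le_trans (measureU2 _ _ _) _ => //; first exact: bigcupT_measurable.
by rewrite [X in (_ + X)%E]lim0 adde0.
Qed.

End last_exit.

(** * Moment generating functions of Gaussian variables *)

(** The Radon-Nikodym derivative and [normal_pdf] have the same integral over every measurable set,
    hence are equal almost everywhere. *)
Lemma ge0_integral_normal_prob (R : realType) (m s : R) (f : R -> \bar R) :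
  measurable_fun setT f -> (forall x, 0 <= f x)%E ->
  (\int[normal_prob m s]_x f x =
   \int[lebesgue_measure]_x (f x * (normal_pdf m s x)%:E))%E.
Proof.
move=> mf f0; have dom := normal_prob_dominates m s.
have mpdf : measurable_fun setT (fun x => (normal_pdf m s x)%:E).
  by apply/measurable_EFinP; exact: measurable_normal_pdf.
have RNint := Radon_Nikodym_SigmaFinite.f_integrable dom.
rewrite -(Radon_Nikodym_SigmaFinite.change_of_variables dom f0 measurableT mf).
apply: ae_eq_integral => //.
- by apply: emeasurable_funM => //; exact: measurable_int RNint.
- exact: emeasurable_funM.
- apply: ae_eqe_mul2l; apply: integral_ae_eq => //.
  by move=> E _ mE; rewrite -(Radon_Nikodym_SigmaFinite.f_integral dom).
Qed.
(** Completing the square: an exponential tilt moves the mean by [r * s ^+ 2] and keeps the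
    variance. *)
Lemma normal_pdf_tilt (R : realType) (m s r x : R) : s != 0 ->
  expR (r * x) * normal_pdf m s x =
  expR (r * m + r ^+ 2 * s ^+ 2 / 2) * normal_pdf (m + r * s ^+ 2) s x.
Proof.
move=> s0; rewrite !normal_pdfE// /normal_fun mulrCA [RHS]mulrCA; congr (_ * _).
rewrite -!expRD; congr expR; rewrite -[s ^+ 2 *+ 2]mulr_natr; field; exact: s0.
Qed.
Lemma gaussian_mgf d (T : measurableType d) (R : realType) (P : {measure set T -> \bar R})
    (X : T -> R) :
  measurable_fun setT X -> is_gaussian (pushforward P X) ->
  exists m s : R, forall r,
    (\int[P]_w (expR (r * X w))%:E = (expR (r * m + r ^+ 2 * s ^+ 2 / 2))%:E)%E.
Proof.
move=> mX [m [s h]]; exists m, s => r.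
pose Y : T -> measurableTypeR R := X.
have mY : measurable_fun setT Y by exact: mX.
have mexp : measurable_fun setT (fun x : measurableTypeR R => (expR (r * x))%:E).
  apply/measurable_EFinP; apply: measurableT_comp => //; exact: measurable_funM.
have := @ge0_integral_pushforward _ _ _ _ R Y mY P setT (fun x => (expR (r * x))%:E)
  measurableT mexp (fun x _ => expR_ge0 _).
(* For [s = 0] the law is a point mass; the formula persists because its variance term vanishes. *)
rewrite preimage_setT => <-; have [s0|s0] := eqVneq s 0.
  transitivity (\int[\d_(m : measurableTypeR R)]_x (expR (r * x))%:E)%E.
    by apply: eq_measure_integral => A mA _; apply: etrans (h A mA) _; rewrite s0 eqxx.
  by rewrite integral_dirac// diracT mul1e s0 expr0n mulr0 mul0r addr0.
transitivity (\int[normal_prob m s]_x (expR (r * x))%:E)%E.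
  apply: eq_measure_integral.
  by move=> A mA _; apply: etrans (h A mA) _; rewrite (negbTE s0).
rewrite ge0_integral_normal_prob//.
under eq_integral do rewrite -EFinM normal_pdf_tilt// EFinM.
rewrite integralZl//; last exact: integrable_normal_pdf.
by rewrite integral_normal_pdf mule1.
Qed.

Section gaussian_moments.
Context d (T : measurableType d) (R : realType) (P : {measure set T -> \bar R}).
Variable Z : T -> R.
Hypothesis mZ : measurable_fun setT Z.
Hypothesis gZ : is_gaussian (pushforward P Z).

Lemma gaussian_exp_integrable r : P.-integrable setT (EFin \o (fun x => expR (r * Z x))).
Proof.
have [m [s h]] := gaussian_mgf mZ gZ.
apply/integrableP; split.
  apply/measurable_EFinP; apply: measurableT_comp => //; exact: measurable_funM.
under eq_integral => x _ do rewrite /= ger0_norm ?expR_ge0//.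
by rewrite h ltry.
Qed.

Let intw r : P.-integrable setT (EFin \o (fun x => 1 * expR (r * Z x))).
Proof. by under eq_fun do rewrite mul1r; exact: gaussian_exp_integrable. Qed.

Lemma gaussian_moment_integrable k r :
  P.-integrable setT (EFin \o (fun x => Z x ^+ k * expR (r * Z x))).
Proof.
have := exp_moment_integrable mZ intw k r.
by under eq_fun do rewrite mul1r.
Qed.

(** The parameters in [is_gaussian] are only known to exist. The first two derivatives of the moment
    generating function at 0 identify them with the mean and, once the mean is 0, the second
    moment. *)
Lemma centered_gaussian_mgf r : \int[P]_x Z x = 0 ->
  \int[P]_x expR (r * Z x) = expR (r ^+ 2 * (\int[P]_x Z x ^+ 2) / 2).
Proof.
move=> Z0; have [m [s h]] := gaussian_mgf mZ gZ.
pose q (r : R) := r * m + r ^+ 2 * s ^+ 2 / 2.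
have M0 : (fun r => \int[P]_x (1 * (Z x ^+ 0 * expR (r * Z x)))) = (fun r => 1 * expR (q r)).
  apply/funext => t; rewrite mul1r.
  by under eq_Rintegral do rewrite mul1r expr0 mul1r; rewrite /Rintegral h.
have dq (t : R) : is_derive t 1 q (m + t * s ^+ 2).
  by apply: is_derive_eq; rewrite /GRing.scale/= /GRing.scale/=; field.
have M1 : (fun r => \int[P]_x (1 * (Z x ^+ 1 * expR (r * Z x)))) =
    (fun r => (m + r * s ^+ 2) * expR (q r)).
  apply/funext => t; have [_ <-] := exp_moment_derive mZ intw 0 t.
  by rewrite M0; have [_ ->] := is_derive_MexpR 1 (dq t); rewrite mul1r.
have q0 : q 0 = 0 by rewrite /q mul0r expr0n/= !mul0r addr0.
have m0 : m = 0.
  have := congr1 (@^~ 0) M1; rewrite /= q0 expR0 mul0r addr0 mulr1 => <-.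
  by rewrite -[RHS]Z0; apply: eq_Rintegral => x _; rewrite mul0r expR0 mulr1 mul1r expr1.
have M2 : \int[P]_x Z x ^+ 2 = s ^+ 2.
  have [_] := exp_moment_derive mZ intw 1 0.
  rewrite M1 m0.
  have dm : is_derive (0 : R) 1 (fun r => (0 + r * s ^+ 2) * expR (q r)) (s ^+ 2).
    have dl := is_derive_mulrr (s ^+ 2) (0 : R).
    have de := is_derive_MexpR 1 (dq 0).
    rewrite (_ : (fun r => _) = (fun r : R => r * s ^+ 2) * (fun r => 1 * expR (q r))).
      apply: is_derive_eq; rewrite /GRing.scale/= q0 expR0; ring.
    by apply/funext => t; rewrite fctE add0r mul1r.
  have [_ ->] := dm; move=> ->.
  by apply: eq_Rintegral => x _; rewrite mul0r expR0 mulr1 mul1r.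
rewrite /Rintegral h/= m0 mulr0 add0r; congr (expR (_ * _ / _)).
by rewrite -M2.
Qed.

End gaussian_moments.

(** * Cameron-Martin shift and derivative in the level *)

Section cameron_martin.
Context d (T : measurableType d) (R : realType) (P : probability T R).
Variables (I : finType) (X : T -> I -> R) (c : I -> R).
Hypothesis mX : forall i, measurable_fun setT (X ^~ i).
Hypothesis gX : forall a : I -> R, is_gaussian (pushforward P (fun x => dot a (X x))).
Hypothesis X_centered : forall i, \int[P]_x X x i = 0.

Let mdot a : measurable_fun setT (fun x => dot a (X x)).
Proof. exact: measurable_dot. Qed.

Lemma dot_integrable a : P.-integrable setT (EFin \o (fun x => dot a (X x))).
Proof.
have := gaussian_moment_integrable (mdot a) (gX a) 1 0.
by under eq_fun do rewrite mul0r expR0 mulr1 expr1.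
Qed.

Lemma dot_delta (i : I) (u : I -> R) : dot (fun j => (j == i)%:R) u = u i.
Proof.
rewrite /dot (bigD1 i)//= eqxx mul1r big1 ?addr0// => j /negbTE ->.
by rewrite mul0r.
Qed.

Lemma coord_integrable i : P.-integrable setT (EFin \o (fun x => X x i)).
Proof.
have := dot_integrable (fun j => (j == i)%:R).
by under eq_fun do rewrite dot_delta.
Qed.

Lemma Rintegral_sum_fin (F : I -> T -> R) :
  (forall i, P.-integrable setT (EFin \o F i)) ->
  \int[P]_x (\sum_i F i x) = \sum_i \int[P]_x F i x.
Proof.
move=> iF; elim: (index_enum I) => [|i s ih].
  by under eq_Rintegral do rewrite big_nil; rewrite big_nil Rintegral_cst// mul0r.
rewrite big_cons -ih -RintegralD//; last first.
  apply: eq_integrable (integrable_sum measurableT s (fun i _ => iF i)) => // x _.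
  by rewrite /= sumEFin.
by apply: eq_Rintegral => x _; rewrite big_cons.
Qed.

Lemma dot_centered a : \int[P]_x dot a (X x) = 0.
Proof.
rewrite Rintegral_sum_fin => [|i]; last exact: (integrableZl measurableT _ (coord_integrable i)).
by rewrite big1// => i _; rewrite RintegralZl// ?X_centered ?mulr0//; exact: coord_integrable.
Qed.

Lemma dot_sqr_integrable a : P.-integrable setT (EFin \o (fun x => dot a (X x) ^+ 2)).
Proof.
have := gaussian_moment_integrable (mdot a) (gX a) 2 0.
by under eq_fun do rewrite mul0r expR0 mulr1.
Qed.

(** Polarization reduces products to squares of linear forms, which are Gaussian moments. *)
Lemma dotM_integrable a b :
  P.-integrable setT (EFin \o (fun x => dot a (X x) * dot b (X x))).
Proof.
have := integrableZl measurableT (1 / 2) (integrableB measurableT (integrableB measurableT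
  (dot_sqr_integrable (fun i => a i + b i)) (dot_sqr_integrable a)) (dot_sqr_integrable b)).
apply: eq_integrable => // x _ /=.
by rewrite -!EFinB -EFinM dotD; congr EFin; field.
Qed.

Lemma coordM_integrable i j :
  P.-integrable setT (EFin \o (fun x => X x i * X x j)).
Proof.
have := dotM_integrable (fun k => (k == i)%:R) (fun k => (k == j)%:R).
by under eq_fun do rewrite !dot_delta.
Qed.

Lemma coord_dot_cov i a :
  \int[P]_x (X x i * dot a (X x)) = \sum_j a j * \int[P]_x (X x i * X x j).
Proof.
under eq_Rintegral do rewrite /dot mulr_sumr.
rewrite Rintegral_sum_fin => [|j]; last first.
  by under eq_fun do rewrite mulrCA; exact: (integrableZl measurableT _ (coordM_integrable i j)).
apply: eq_bigr => j _; under eq_Rintegral do rewrite mulrCA.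
by rewrite RintegralZl//; exact: coordM_integrable.
Qed.

Definition dot_cov a b := \int[P]_x (dot a (X x) * dot b (X x)).

Lemma dot_covDZ a b t :
  \int[P]_x dot (fun i => a i + t * b i) (X x) ^+ 2 =
  dot_cov a a + 2 * t * dot_cov a b + t ^+ 2 * dot_cov b b.
Proof.
have iZ r a' b' := integrableZl measurableT r (dotM_integrable a' b').
rewrite /dot_cov -!RintegralZl//; try exact: dotM_integrable.
rewrite -!RintegralD//; try exact: dotM_integrable; try exact: iZ.
- apply: eq_Rintegral => x _; rewrite dotD dotZ; ring.
- exact: (integrableD measurableT (dotM_integrable a a) (iZ _ _ _)).
Qed.

Lemma dot_mgf a : \int[P]_x expR (dot a (X x)) = expR (dot_cov a a / 2).
Proof.
have := centered_gaussian_mgf (mdot a) (gX a) 1 (dot_centered a).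
under eq_Rintegral do rewrite mul1r.
by move=> ->; rewrite expr1n mul1r; congr (expR (_ / _)); apply: eq_Rintegral => x _; rewrite expr2.
Qed.

Lemma dot_exp_integrable a : P.-integrable setT (EFin \o (fun x => expR (dot a (X x)))).
Proof.
have := gaussian_exp_integrable (mdot a) (gX a) 1.
by under eq_fun do rewrite mul1r.
Qed.

(* The Cameron-Martin direction dual to [dot c] is the constant vector 1. *)
Hypothesis cov1 : forall i, \int[P]_x (X x i * dot c (X x)) = 1.

Lemma dot_cov_dual a : dot_cov a c = \sum_i a i.
Proof.
have iX i : P.-integrable setT (EFin \o (fun x => X x i * dot c (X x))).
  have := dotM_integrable (fun j => (j == i)%:R) c.
  by under eq_fun do rewrite dot_delta.
rewrite /dot_cov.
under eq_Rintegral do rewrite {1}/dot mulr_suml.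
rewrite Rintegral_sum_fin => [|i]; last first.
  by under eq_fun do rewrite -mulrA; exact: (integrableZl measurableT _ (iX i)).
apply: eq_bigr => i _; under eq_Rintegral do rewrite -mulrA.
by rewrite RintegralZl// cov1 mulr1.
Qed.

(** Both transforms are explicit. The shift contributes [t] times the sum of the [a i]; the tilt
    contributes the cross term [t * dot_cov a c], the same number by [dot_cov_dual], while the
    normalisation cancels the term in [t ^+ 2]. *)
Lemma cameron_martin t (a : I -> R) :
  agree P (fun x i => X x i + t) X (fun=> 1)
    (fun x => expR (t * dot c (X x) - t ^+ 2 * dot_cov c c / 2))
    (fun u => expR (dot a u)).
Proof.
have dott x : dot a (fun i => X x i + t) = dot a (X x) + t * \sum_i a i.
  rewrite /dot mulr_sumr -big_split; apply: eq_bigr => i _ /=; ring.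
have eL : (fun x => 1 * expR (dot a (fun i => X x i + t))) =
    (fun x => expR (t * \sum_i a i) * expR (dot a (X x))).
  by apply/funext => x; rewrite mul1r dott addrC expRD.
have eR : (fun x => expR (t * dot c (X x) - t ^+ 2 * dot_cov c c / 2) * expR (dot a (X x))) =
    (fun x => expR (- (t ^+ 2 * dot_cov c c / 2)) * expR (dot (fun i => a i + t * c i) (X x))).
  apply/funext => x; rewrite -!expRD dotD dotZ; congr expR; ring.
split; rewrite ?eL ?eR.
- exact: (integrableZl measurableT _ (dot_exp_integrable _)).
- exact: (integrableZl measurableT _ (dot_exp_integrable _)).
rewrite RintegralZl//; last exact: dot_exp_integrable.
rewrite RintegralZl//; last exact: dot_exp_integrable.
rewrite !dot_mgf -!expRD; congr expR.
have -> : dot_cov (fun i => a i + t * c i) (fun i => a i + t * c i) =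
    \int[P]_x dot (fun i => a i + t * c i) (X x) ^+ 2.
  by apply: eq_Rintegral => x _; rewrite expr2.
by rewrite dot_covDZ (dot_cov_dual a); field.
Qed.

Variable A : {set {ffun I -> bool}}.

Definition level (h : R) (u : I -> R) : R := ([ffun i => (h <= u i)%R] \in A)%:R.

Lemma levelD h t u : level h (fun i => u i + t) = level (h - t) u.
Proof.
rewrite /level; suff -> : [ffun i => (h <= u i + t)%R] = [ffun i => (h - t <= u i)%R] by [].
by apply/ffunP => i; rewrite !ffunE lerBlDr.
Qed.

Let level_agree h t : agree P (fun x i => X x i + t) X (fun=> 1)
  (fun x => expR (t * dot c (X x) - t ^+ 2 * dot_cov c c / 2)) (level h).
Proof.
apply: agree_level => //; last exact: cameron_martin.
by move=> i; exact: measurable_funD.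
Qed.

Lemma level_exp_integrable h t :
  P.-integrable setT (EFin \o (fun x => level h (X x) * expR (t * dot c (X x)))).
Proof.
have [_ i _] := level_agree h t.
have := integrableZl measurableT (expR (t ^+ 2 * dot_cov c c / 2)) i.
apply: eq_integrable => // x _ /=.
by rewrite -EFinM mulrA -expRD addrC subrK mulrC.
Qed.

Lemma measurable_level h : measurable [set x | [ffun i => (h <= X x i)%R] \in A].
Proof.
have mlevel : measurable_fun setT (fun x => level h (X x)).
  have /integrableP[+ _] := level_exp_integrable h 0; move/measurable_EFinP.
  by apply: eq_measurable_fun => x _; rewrite mul0r expR0 mulr1.
rewrite (_ : mkset _ = setT `&` (fun x => level h (X x)) @^-1` [set 1]).
  by apply: mlevel => //; exact: measurable_set1.
rewrite setTI; apply/seteqP; split => x; rewrite /= /level; first by move=> ->.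
by case: (_ \in _) => // /eqP; rewrite eq_sym oner_eq0.
Qed.

Lemma level_dot_integrable h :
  P.-integrable setT (EFin \o (fun x => level h (X x) * dot c (X x))).
Proof.
have := exp_moment_integrable (mdot c) (level_exp_integrable h) 1 0.
by under eq_fun do rewrite mul0r expR0 mulr1 expr1.
Qed.

(** Raising the field by [t] amounts to lowering the level by [t]. The power 0 is kept so that the
    integral is literally the function that [exp_moment_derive] differentiates at [k = 0]. *)
Lemma level_shift h t :
  \int[P]_x level (h - t) (X x) =
  expR (- (t ^+ 2 * dot_cov c c / 2)) *
    \int[P]_x (level h (X x) * (dot c (X x) ^+ 0 * expR (t * dot c (X x)))).
Proof.
have [_ _ e] := level_agree h t.
rewrite -RintegralZl//; last first.
  exact: (exp_moment_integrable (mdot c) (level_exp_integrable h) 0 t).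
transitivity (\int[P]_x (1 * level h (fun i => X x i + t))).
  by apply: eq_Rintegral => x _; rewrite mul1r levelD.
rewrite e; apply: eq_Rintegral => x _.
by rewrite expr0 mul1r mulrCA -expRD mulrC addrC.
Qed.

Lemma level_derive (h : R) :
  is_derive h 1 (fun t => \int[P]_x level t (X x))
    (- \int[P]_x (level h (X x) * dot c (X x))).
Proof.
pose s2 := dot_cov c c / 2.
have dN := exp_moment_derive (mdot c) (level_exp_integrable h) 0 0.
set N := (fun r => Rintegral _ _ _) in dN.
(* The exponent is quadratic, so to first order at 0 the normalising factor is the constant 1 and
   only the derivative of [N] remains. *)
have dq : is_derive (0 : R) 1 (fun t : R => - (t ^+ 2 * s2)) 0.
  by apply: is_derive_eq; rewrite /GRing.scale/=; ring.
have dE := is_derive_MexpR 1 dq.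
have dp : is_derive (0 : R) 1 ((fun t : R => 1 * expR (- (t ^+ 2 * s2))) * N)
    (\int[P]_x (level h (X x) * dot c (X x))).
  apply: is_derive_eq; rewrite /GRing.scale/= mul0r mulr0 mulr0 addr0.
  rewrite expr0n/= mul0r oppr0 expR0 !mul1r.
  by apply: eq_Rintegral => x _; rewrite mul0r expR0 mulr1 expr1.
(* Level [t] is reached from [h] by the shift [h - t], which vanishes at [t = h]; the chain rule
   supplies the minus sign. *)
rewrite (_ : (fun t => _) = ((fun t : R => 1 * expR (- (t ^+ 2 * s2))) * N) \o (fun t => h - t)).
  have dl : is_derive h 1 (fun t : R => h - t) (- 1).
    by have := is_deriveB (is_derive_cst h h (1 : R)) (is_derive_id h (1 : R)); rewrite sub0r.
  rewrite -(subrr h) in dp.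
  have := @is_derive1_comp _ _ _ h _ _ dp dl.
  by move=> /is_derive_eq; apply; rewrite mulrN1.
apply/funext => t /=; rewrite fctE -[in LHS](subKr h t) level_shift mul1r.
by rewrite /s2 mulrA.
Qed.

End cameron_martin.

(** * From the field on the whole graph to a Gaussian vector on K *)

Section field.
Context (R : realType) (d : nat) (G : ambient).
Context (C : vertex d G -> vertex d G -> \bar R).
Context (PG : probability (field_space R d G) R).
Hypothesis hPG : is_centered_gaussian_field C PG.
Variable K : {fset vertex d G}.

Definition restriction (phi : field_space R d G) (i : K) : R := phi (val i).

Lemma measurable_restriction i : measurable_fun setT (restriction ^~ i).
Proof.
move=> _ V mV; rewrite setTI; apply: sub_sigma_algebra.
by exists (val i), V.
Qed.

Lemma sum_restriction (a : vertex d G -> R) phi :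
  \sum_(x <- K) a x * phi x = dot (fun i : K => a (val i)) (restriction phi).
Proof. by rewrite big_seq_fsetE. Qed.

Lemma restriction_gaussian (a : K -> R) :
  is_gaussian (pushforward PG (fun phi => dot a (restriction phi))).
Proof.
have [hg _ _] := hPG.
(* The field hypothesis takes coefficients on all vertices, so [a] is extended by 0 outside K. *)
have := hg K (fun x => oapp a 0 (insub x)); congr (is_gaussian (pushforward _ _)).
apply/funext => phi; rewrite sum_restriction.
by apply: eq_bigr => i _; rewrite valK.
Qed.

Lemma restriction_centered i : \int[PG]_phi restriction phi i = 0.
Proof. by have [_ /(_ (val i)) + _] := hPG; rewrite unlock /Rintegral => ->. Qed.

Lemma restriction_cov i j :
  C (val i) (val j) = (\int[PG]_phi (restriction phi i * restriction phi j))%:E.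
Proof.
have [_ h0 <-] := hPG.
rewrite unlock !h0 /= unlock /Rintegral fineK.
  by apply: eq_integral => phi _; rewrite fctE /= !subr0.
exact: integrable_fin_num (coordM_integrable measurable_restriction restriction_gaussian i j).
Qed.

Lemma indic_level_event (A : {set {ffun K -> bool}}) t phi :
  \1_(level_event A t) phi = level A t (restriction phi) :> R.
Proof. by rewrite indicE /level; congr (nat_of_bool _)%:R; apply/idP/idP; rewrite inE. Qed.

End field.

Theorem proposition2p2 (R : realType) (d : nat) (G : ambient) (theta : R)
  (hd : (3 <= d)%N)
  (htheta : 0 <= theta <= 1)
  (hG : forall L : nat, G = Torus L -> (1 <= L)%N /\ theta != 0)
  (P : vertex d G -> probability (path_space d G) R)
  (hP : forall x : vertex d G, is_killed_walk_law theta x (P x))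
  (PG : probability (field_space R d G) R)
  (hPG : is_centered_gaussian_field (green P) PG)
  (K : {fset vertex d G}) (A : {set {ffun K -> bool}}) (h : R) :
  derivable (fun t : R => fine (PG (level_event A t))) h 1 /\
  (- (fun t : R => fine (PG (level_event A t)))^`()%classic h)%:E =
  ('E_PG[fun phi : field_space R d G =>
     (\1_(level_event A h) phi * \sum_(x <- K) kappa_tr P K x * phi x)%R])%E.

Proof.
pose c (i : K) := kappa_tr P K (val i).
pose X := @restriction R d G K.
have mX := @measurable_restriction R d G K.
have gX := @restriction_gaussian _ _ _ _ _ hPG K.
have zX := @restriction_centered _ _ _ _ _ hPG K.
have cov1 (i : K) : \int[PG]_phi (X phi i * dot c (X phi)) = 1.
  apply: EFin_inj; rewrite -(sum_green_kappa htheta hP (fsvalP i)); last first.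
    (* Green values between points of K are covariances of the field, hence real numbers. *)
    move=> y yK; have := restriction_cov hPG i (FSetSub yK) => /= ->.
    exact: ltry.
  rewrite big_seq_fsetE/=.
  rewrite (coord_dot_cov mX gX) -sumEFin; apply: eq_bigr => k _.
  by rewrite (restriction_cov hPG) -EFinM mulrC.
have pE (t : R) : fine (PG (level_event A t)) = \int[PG]_phi level A t (X phi).
  have mA := measurable_level mX gX zX cov1 A t.
  rewrite -[level_event A t]setIT -integral_indic//.
  by congr fine; apply: eq_integral => phi _; rewrite indic_level_event.
rewrite (funext pE).
have := level_derive mX gX zX cov1 A h; set e := Rintegral _ _ _ => he.
split; first by have [] := he.
rewrite derive1E; have [_ ->] := he; rewrite opprK unlock /e /Rintegral fineK.
  apply: eq_integral => phi _; congr (_%:E).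
  by rewrite sum_restriction indic_level_event.
exact: integrable_fin_num (level_dot_integrable mX gX zX cov1 A h).
Qed.
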